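(* Let $\Gamma=\langle\alpha,\beta\rangle$ be a numerical semigroup, where $\alpha<\beta$ are coprime positive integers, and suppose that $\alpha$ is even and $\beta$ is odd. Then, counted up to isomorphism, there are in total \[ \binom{\lfloor\frac{\alpha}{2}\rfloor+\lfloor\frac{\beta}{2}\rfloor}{\lfloor\frac{\alpha}{2}\rfloor} \] selfdual $\Gamma$-semimodules. In particular there are exactly \[ \binom{\frac{\alpha}{2}-1}{\ell}\binom{\lfloor\frac{\beta}{2}\rfloor}{\ell} \] selfdual $\Gamma$-semimodules with $2\ell+1$ (minimal) generators for each $\ell=0,\ldots,\frac{\alpha}{2}-1$, and exactly \[ \binom{\frac{\alpha}{2}-1}{\ell-1}\binom{\lfloor\frac{\beta}{2}\rfloor}{\ell} \] selfdual $\Gamma$-semimodules with $2\ell$ (minimal) generators for each $\ell=1,\ldots,\frac{\alpha}{2}$.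
   Context: Here $\mathbb{N}=\{0,1,2,\ldots\}$. A numerical semigroup $\Gamma$ is a submonoid of $(\mathbb{N},+)$ with finite complement in $\mathbb{N}$; $\langle\alpha,\beta\rangle=\{r\alpha+s\beta : r,s\in\mathbb{N}\}$. A $\Gamma$-semimodule is a non-empty subset $\Delta\subseteq\mathbb{Z}$ that is bounded below and satisfies $\Delta+\Gamma\subseteq\Delta$. A system of generators of $\Delta$ is a subset $\mathcal{E}\subseteq\Delta$ with $\bigcup_{x\in\mathcal{E}}(x+\Gamma)=\Delta$; every $\Gamma$-semimodule has a unique minimal system of generators, which is finite, and ''number of generators'' means its cardinality. A map $f:\Delta\to\Delta'$ of $\Gamma$-semimodules is a homomorphism if $f(\gamma+x)=\gamma+f(x)$ for all $\gamma\in\Gamma$, $x\in\Delta$; $\Delta$ and $\Delta'$ are isomorphic if there is a bijective homomorphism between them, equivalently $\Delta'=\Delta+c$ for some $c\in\mathbb{Z}$. The dual of $\Delta$ is $\Delta^*=\{c\in\mathbb{Z} : c+\Delta\subseteq\Gamma\}$, and $\Delta$ is called selfdual if $\Delta^*\cong\Delta$. *)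

(* Defs.v *)
From mathcomp Require Import all_boot all_order all_algebra.
From mathcomp Require Import zify.
From mathcomp Require Import boolp classical_sets functions cardinality.

Set Implicit Arguments.
Unset Strict Implicit.
Unset Printing Implicit Defensive.

Import Order.TTheory GRing.Theory Num.Theory.

Local Open Scope classical_set_scope.
Local Open Scope card_scope.
Local Open Scope ring_scope.

Definition numerical_semigroup (G : set nat) : Prop :=
  [/\ G 0%N, (forall m n, G m -> G n -> G (m + n)%N) & cofinite_set G].

Definition semigroup2 (alpha beta : nat) : set nat :=
  [set n | exists r s : nat, n = (r * alpha + s * beta)%N].

Lemma semigroup2_numerical (alpha beta : nat) :
  (0 < alpha)%N -> coprime alpha beta ->
  numerical_semigroup (semigroup2 alpha beta).
Proof.
move=> alpha_gt0 co_ab; split.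
- by exists 0%N, 0%N.
- move=> _ _ [r [s ->]] [r' [s' ->]]; exists (r + r')%N, (s + s')%N.
  by rewrite !mulnDl addnACA.
apply: (@sub_finite_set _ _ `I_(alpha * beta)); last exact: finite_II.
move=> n /= nGn; rewrite ltnNge; apply/negP => le_ab_n; apply: nGn.
have [u v def_u _] := egcdnP beta alpha_gt0.
move: def_u; rewrite (eqP co_ab) => def_u.
(* [s] is the least solution of s * beta = n modulo alpha *)
pose s := ((n * v * alpha.-1) %% alpha)%N.
have lt_s : (s < alpha)%N by rewrite ltn_mod.
have le_sb : (s * beta <= n)%N.
  by apply: leq_trans le_ab_n; rewrite leq_mul2r (ltnW lt_s) orbT.
have eq_mod : (s * beta = n %[mod alpha])%N.
  have e1 : (n * v * alpha.-1 * beta + n * v * beta = n * v * beta * alpha)%N.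
    by case: (alpha) alpha_gt0 => // a _ /=; rewrite mulnS; nia.
  have e2 : (n * v * beta + n = n * u * alpha)%N.
    by rewrite -!mulnA def_u mulnDr muln1.
  apply/eqP; rewrite /s modnMml -(eqn_modDl (n * v * beta)) addnC e1 e2.
  by rewrite !modnMl.
exists ((n - s * beta) %/ alpha)%N, s.
rewrite divnK ?subnK //.
by rewrite -(eqn_mod_dvd _ le_sb) eq_mod.
Qed.

Definition semimodule (G : set nat) (D : set int) : Prop :=
  [/\ D !=set0, has_lbound D & forall x g, D x -> G g -> D (x + g%:Z)].

Definition generates (G : set nat) (E D : set int) : Prop :=
  E `<=` D /\ \bigcup_(x in E) [set x + g%:Z | g in G] = D.

Definition minimal_generators (G : set nat) (E D : set int) : Prop :=
  generates G E D /\ forall E', E' `<=` E -> generates G E' D -> E' = E.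

Definition has_num_generators (G : set nat) (D : set int) (n : nat) : Prop :=
  exists2 E, minimal_generators G E D & E #= `I_n.

(* A map D -> D' is represented by a total function on [int], of which only
   the values on D matter. *)
Definition isomorphic (G : set nat) (D D' : set int) : Prop :=
  exists2 f : int -> int, set_bij D D' f &
    forall g x, G g -> D x -> f (g%:Z + x) = g%:Z + f x.

Definition dual (G : set nat) (D : set int) : set int :=
  [set c | [set c + x | x in D] `<=` [set g%:Z | g in G]].

Definition selfdual (G : set nat) (D : set int) : Prop :=
  isomorphic G (dual G D) D.

Definition iso_class (G : set nat) (D : set int) : set (set int) :=
  [set D' | semimodule G D' /\ isomorphic G D D'].

Definition count_up_to_iso (G : set nat) (P : set (set int)) (n : nat) : Prop :=
  [set iso_class G D | D in [set D | semimodule G D /\ P D]] #= `I_n.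

(* Main.v *)
Require Import Defs.
From mathcomp Require Import all_boot all_order all_algebra.
From mathcomp Require Import zify.
From mathcomp Require Import boolp classical_sets functions cardinality.

(** Why the theorem holds.  Write every integer as [pt j k], that is
    [j * alpha - k * beta]; the pair (j, k) is unique up to adding multiples
    of (beta, alpha).  A semimodule [D] is closed under adding [alpha] and
    [beta], so it is the set of the [pt j k] with [t k <= j] for a
    nondecreasing [t : int -> int] such that
    [t (k + alpha) = t k + beta]: a staircase in the plane.

    The semigroup is symmetric: [x] belongs to it exactly when [F - x] does
    not, where [F = alpha * beta - alpha - beta]
    ([semigroup_symmetric]).  Hence the dual of [D] is the complement of [D]
    reflected in [F] ([dualE]), and [D] is selfdual exactly when, for
    some [N], [x] is in [D] iff [N - x] is not.  Such an [N] cannot be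
    even, because of [x = N / 2], and translating [D] by [c] changes it by
    [2 * c].  As [beta - alpha] is odd, exactly one translate of [D] has
    [N = beta - alpha]; that translate is called centered
    ([selfdual_centered], [centered_shift_uniq]).  So isomorphism classes of
    selfdual semimodules are in bijection with centered semimodules.

    In terms of staircases, centered means [t (-1 - k) = - t k]
    ([exists_profile]).  With [alpha = 2a] and [beta = 2b + 1], such a [t]
    is determined by its values at 0, ..., a - 1, and these can be any
    nondecreasing sequence of numbers between 0 and b ([seq_profile_profile],
    [profile_seq]).  There are ['C(a + b, a)] of them.

    Finally, the minimal generators of [D] are the elements [x] of [D] with
    neither [x - alpha] nor [x - beta] in [D]; they are the corners of the
    staircase, one for each [k] modulo [alpha] with [t k < t (k + 1)]
    ([card_irreducibles]).  Over the period from -a to a - 1, each ascent of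
    the sequence [s] of values contributes two corners by symmetry, the step
    from -1 to 0 gives one exactly when the first term of [s] is positive,
    and the last step always gives one, because [beta] is odd
    ([seq_profile_generators]).  So the parity of the number of generators
    says whether [s] starts with 0, and the refined formulas count
    nondecreasing sequences by their first term and number of ascents
    ([count_jumps_odd], [count_jumps_even]). *)

Set Implicit Arguments.
Unset Strict Implicit.
Unset Printing Implicit Defensive.

Import Order.TTheory GRing.Theory Num.Theory.

Local Open Scope classical_set_scope.

(** * Nondecreasing sequences and their ascents *)

(** An enumeration of the nondecreasing sequences of length [n] with terms
    between [v] and [v + m].  It splits them by whether the first term attains
    the lower bound, because this decides if a comparison with [v] is an
    ascent. *)
Fixpoint mono_seqs (n : nat) : nat -> nat -> seq (seq nat) :=
  if n isn't n'.+1 then fun _ _ => [:: [::]] else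
  fix raise m v := [seq v :: s | s <- mono_seqs n' m v] ++
                   (if m is m'.+1 then raise m' v.+1 else [::]).

Lemma mono_seqsS n m v :
  mono_seqs n.+1 m v = [seq v :: s | s <- mono_seqs n m v] ++
                       (if m is m'.+1 then mono_seqs n.+1 m' v.+1 else [::]).
Proof. by case: m. Qed.

Lemma mem_mono_seqs n m v s :
  (s \in mono_seqs n m v) =
  [&& size s == n, path leq v s & all (fun x => x <= v + m) s].
Proof.
elim: n m v s => [|n IHn] m v s /=; first by case: s => [|x s].
have mem_head u k : (s \in [seq u :: r | r <- mono_seqs n k u]) =
    [&& ohead s == Some u, size s == n.+1, path leq u s
      & all (fun x => x <= u + k) s].
  apply/mapP/idP => [[r]|].
    rewrite IHn => /and3P[/eqP <- pr ar] -> /=.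
    by rewrite !eqxx leqnn pr leq_addr.
  case: s => [|x s] //= /andP[/eqP[->]] /andP[]; rewrite eqSS => sz.
  by case/andP=> /andP[_ ps] /andP[_ al]; exists s => //; rewrite IHn sz ps.
elim: m v mem_head => [|m IHm] v mem_head; rewrite mem_cat mem_head.
  rewrite in_nil orbF; case: s {mem_head IHn} => [|x s] //=.
  have -> : (Some x == Some v) = (x == v) by [].
  by rewrite addn0; case: (ltngtP v x) => [lt_vx|lt_xv|->] //=; rewrite ?andbF.
rewrite {}IHm //; case: s {mem_head IHn} => [|x s] //=; rewrite addSnnS.
have -> : (Some x == Some v) = (x == v) by [].
case: (ltngtP v x) => [lt_vx|lt_xv|->] //=; rewrite ?andbF ?orbF //=.
Qed.

Lemma mono_seqs_uniq n m v : uniq (mono_seqs n m v).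
Proof.
elim: n m v => [|n IHn] m v //.
have cons_inj u : injective (cons u : seq nat -> seq nat) by move=> s s' [].
elim: m v => [|m IHm] v;
  rewrite mono_seqsS cat_uniq (map_inj_uniq (cons_inj v)) IHn //.
rewrite IHm andbT; apply/hasPn => s.
rewrite mem_mono_seqs => /and3P[_ ps _]; apply/negP => /mapP[r _ eq_s].
by move: ps; rewrite eq_s /= ltnn.
Qed.

Lemma size_mono_seqs n m v : size (mono_seqs n m v) = 'C(n + m, n).
Proof.
elim: n m v => [|n IHn] m v; first by rewrite bin0.
elim: m v => [|m IHm] v; rewrite mono_seqsS size_cat size_map IHn.
  by rewrite !addn0 !binn.
by rewrite IHm [in RHS]addnS binS addnC addSnnS.
Qed.

Definition ascents (s : seq nat) : nat :=
  \sum_(i < (size s).-1) (nth 0 s i < nth 0 s i.+1).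

Lemma ascents_cons2 x y s : ascents [:: x, y & s] = (x < y) + ascents (y :: s).
Proof. by rewrite /ascents /= big_ord_recl. Qed.

(** The two counts below feed each other: removing a first term that attains
    the lower bound [v] leaves a sequence that is compared with [v], and
    raising the lower bound makes the comparison with [v] a sure ascent.
    This is the first half of that mutual recursion. *)
Lemma count_ascents_from_above n :
  (forall m v k, count (fun s => ascents (v :: s) == k) (mono_seqs n m v)
                 = 'C(n, k) * 'C(m, k)) ->
  forall m v k, count (fun s => ascents s == k) (mono_seqs n.+1 m v)
                = 'C(n, k) * 'C(m.+1, k.+1).
Proof.
move=> Hq; elim=> [|m IHm] v k; rewrite mono_seqsS count_cat count_map Hq.
  by case: k => [|k]; rewrite addn0 ?bin0 ?binn // bin0n (@bin_small 1) ?muln0.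
by rewrite IHm [in RHS]binS mulnDr addnC.
Qed.

(** Choose the [k] places of the ascents among [n] and the [k] values reached,
    among the [m] values above [v]. *)
Lemma count_ascents_above n m v k :
  count (fun s => ascents (v :: s) == k) (mono_seqs n m v)
  = 'C(n, k) * 'C(m, k).
Proof.
elim: n m v k => [|n IHn] m v k.
  by rewrite /= /ascents big_ord0; case: k => [|k]; rewrite ?bin0.
have -> : count (fun s => ascents (v :: s) == k) (mono_seqs n.+1 m v)
   = 'C(n, k) * 'C(m, k) +
     (if m is m'.+1 then if k is k'.+1 then 'C(n, k') * 'C(m, k) else 0 else 0).
  rewrite mono_seqsS count_cat count_map -[in RHS](IHn m v k); congr (_ + _).
    by apply: eq_count => s /=; rewrite ascents_cons2 ltnn.
  case: m => [|m] //.
  have -> : count (fun s => ascents (v :: s) == k) (mono_seqs n.+1 m v.+1)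
      = count (fun s => (ascents s).+1 == k) (mono_seqs n.+1 m v.+1).
    apply: eq_in_count => -[|x s]; rewrite mem_mono_seqs //= => /and3P[_ + _].
    by case/andP=> lt_vx _; rewrite ascents_cons2 lt_vx.
  case: k => [|k]; first exact: count_pred0.
  exact: count_ascents_from_above.
by case: m k => [|m] [|k]; rewrite ?bin0 ?muln0 ?muln1 ?addn0 // binS mulnDl.
Qed.

(** Choose the [k] places of the ascents among [n] and the [k.+1] values taken,
    among the [m.+1] possible ones. *)
Lemma count_ascents n m v k :
  count (fun s => ascents s == k) (mono_seqs n.+1 m v)
  = 'C(n, k) * 'C(m.+1, k.+1).
Proof. exact/count_ascents_from_above/count_ascents_above. Qed.

(** The number of ascents, over a period, of the staircase that extends [s] by
    central symmetry. *)
Definition num_jumps (s : seq nat) : nat :=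
  (2 * ascents s + (0 < head 0 s) + 1)%N.

(** An odd number of jumps means that the first term is 0; the other [n] terms
    are then compared with 0. *)
Lemma count_jumps_odd n m l :
  count (fun s => num_jumps s == 2 * l + 1) (mono_seqs n.+1 m 0)
  = 'C(n, l) * 'C(m, l).
Proof.
rewrite mono_seqsS count_cat count_map -(count_ascents_above n m 0).
rewrite (_ : count _ (if m is _.+1 then _ else _) = 0) ?addn0.
  apply: eq_count => s /=; rewrite /num_jumps /=; lia.
case: m => [|m] //.
apply/eqP; rewrite -[_ == 0]negbK -lt0n -has_count; apply/hasPn => -[|x s];
  rewrite mem_mono_seqs //= => /and3P[_ /andP[x_gt0 _] _].
rewrite /num_jumps /= x_gt0; lia.
Qed.

(** An even number of jumps means that all terms are positive. *)
Lemma count_jumps_even n m l :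
  count (fun s => num_jumps s == 2 * l.+1) (mono_seqs n.+1 m.+1 0)
  = 'C(n, l) * 'C(m.+1, l.+1).
Proof.
rewrite mono_seqsS count_cat count_map -(count_ascents n m 1).
rewrite [X in X + _](_ : _ = 0).
  apply: eq_in_count => -[|x s];
    rewrite mem_mono_seqs //= => /and3P[_ /andP[x_gt0 _] _].
  rewrite /num_jumps /= x_gt0; lia.
apply/eqP; rewrite -[_ == 0]negbK -lt0n -has_count; apply/hasPn => s _ /=.
rewrite /num_jumps /=; lia.
Qed.

Section TwoGenerators.

Local Open Scope card_scope.
Local Open Scope ring_scope.

Variables alpha beta : nat.
Hypothesis alpha_gt0 : (0 < alpha)%N.
Hypothesis beta_gt0 : (0 < beta)%N.
Hypothesis co_alpha_beta : coprime alpha beta.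

Local Notation G := (semigroup2 alpha beta).
(* the Frobenius number of [G] *)
Local Notation F := (alpha%:Z * beta%:Z - alpha%:Z - beta%:Z).

(** * Lattice coordinates on the integers *)

Definition pt (j k : int) : int := j * alpha%:Z - k * beta%:Z.

Lemma pt_surj x : exists j k, x = pt j k.
Proof.
have [u [v]] := Bezoutz alpha beta.
have /eqP -> : gcdz alpha beta == 1 by [].
move=> uv1; exists (x * u), (- (x * v)).
rewrite /pt -[LHS]mulr1 -uv1; lia.
Qed.

Lemma pt_inj j k j' k' : pt j k = pt j' k' ->
  exists t : int, j' = j + t * beta%:Z /\ k' = k + t * alpha%:Z.
Proof.
rewrite /pt => eq_pt.
have : (alpha %| (k' - k) * beta%:Z)%Z by apply/dvdzP; exists (j' - j); lia.
rewrite Gauss_dvdzl // => /dvdzP[t def_t]; exists t; split; last by lia.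
have : (j' - j - t * beta%:Z) * alpha%:Z = 0.
  have -> : (j' - j - t * beta%:Z) * alpha%:Z
     = (j' - j) * alpha%:Z - (t * alpha%:Z) * beta%:Z by lia.
  by rewrite -def_t; lia.
by move/eqP; rewrite mulf_eq0 => /orP[/eqP|/eqP]; lia.
Qed.

Lemma int_window (c k : int) :
  exists q r : int, k = q * alpha%:Z + r /\ c <= r < c + alpha%:Z.
Proof.
exists ((k - c) %/ alpha)%Z, (c + ((k - c) %% alpha)%Z).
have e := divz_eq (k - c) alpha.
have a0 : alpha%:Z != 0 by lia.
have := modz_ge0 (k - c) a0.
have : ((k - c) %% alpha)%Z < alpha%:Z by apply: ltz_pmod; lia.
set q := divz _ _ in e *; set r := modz _ _ in e * => lt_r ge_r.
by split; lia.
Qed.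

Lemma pt_window (c x : int) :
  exists j k : int, x = pt j k /\ c <= k < c + alpha%:Z.
Proof.
have [j [k ->]] := pt_surj x; have [q [r [-> r_c]]] := int_window c k.
by exists (j - q * beta%:Z), r; split=> //; rewrite /pt; lia.
Qed.

(** * Symmetry of the semigroup, and duals *)

Lemma semigroup_pt (j k : int) : - alpha%:Z < k <= 0 ->
  [set g%:Z | g in G] (pt j k) <-> 0 <= j.
Proof.
move=> k_range; split=> [[_ [r [s ->]]]|j_ge0].
  have -> : (r * alpha + s * beta)%N%:Z = pt r%:Z (- s%:Z) by rewrite /pt; lia.
  move=> /pt_inj[t [def_j def_k]].
  have t_ge0 : 0 <= t.
    rewrite leNgt; apply/negP => t_lt0.
    have : 0 <= (- 1 - t) * alpha%:Z by rewrite mulr_ge0 //; lia.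
    by lia.
  have : 0 <= t * beta%:Z by rewrite mulr_ge0.
  by lia.
exists (`|j| * alpha + `|k| * beta)%N; first by exists `|j|%N, `|k|%N.
by rewrite /pt; nia.
Qed.

(** The reflection in [F] maps the window of [semigroup_pt] to itself and
    replaces [j] by [-1 - j]. *)
Lemma semigroup_symmetric x :
  [set g%:Z | g in G] x <-> ~ [set g%:Z | g in G] (F - x).
Proof.
have [j [k [-> k_range]]] := pt_window (1 - alpha%:Z) x.
have -> : F - pt j k = pt (- 1 - j) (1 - alpha%:Z - k) by rewrite /pt; lia.
rewrite !semigroup_pt; lia.
Qed.

Lemma semimodule_closed D : semimodule G D -> forall x g,
  D x -> [set n%:Z | n in G] g -> D (x + g).
Proof. by case=> _ _ clD x _ Dx [g Gg <-]; apply: clD. Qed.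

Lemma gen_alpha : G alpha.
Proof. by exists 1%N, 0%N; lia. Qed.

Lemma gen_beta : G beta.
Proof. by exists 0%N, 1%N; lia. Qed.

Lemma dualE D : semimodule G D -> dual G D = [set c | ~ D (F - c)].
Proof.
move=> smD; rewrite predeqE => c; split => [dualc DFc|nDFc _ [x Dx <-]] /=.
  have : [set g%:Z | g in G] F by apply: dualc; exists (F - c) => //; lia.
  case/semigroup_symmetric; exists 0%N; last by lia.
  by exists 0%N, 0%N.
apply/semigroup_symmetric => GF; apply: nDFc.
have -> : F - c = x + (F - (c + x)) by lia.
exact: semimodule_closed.
Qed.

(** * Isomorphisms are translations *)

Definition shift (c : int) (D : set int) : set int := [set x | D (x - c)].

(** Any two integers have a common translate by elements of [G]; this forces a
    homomorphism to be the same translation everywhere. *)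
Lemma common_translate x y :
  exists g h, [/\ G g, G h & x + g%:Z = y + h%:Z].
Proof.
have [j [k def_xy]] := pt_surj (y - x).
exists (`|Num.max j 0| * alpha + `|Num.max (- k) 0| * beta)%N.
exists (`|Num.max (- j) 0| * alpha + `|Num.max k 0| * beta)%N.
split; [by do 2!eexists|by do 2!eexists|].
move: def_xy; rewrite /pt; case: (leP 0 j) => ?; case: (leP 0 k) => ?; nia.
Qed.

Lemma isomorphicE D D' : D !=set0 ->
  isomorphic G D D' <-> exists c, D' = shift c D.
Proof.
case=> x0 Dx0; split=> [[f [f_fun f_inj f_surj] f_hom]|[c ->]].
  have f_trans x : D x -> f x = x + (f x0 - x0).
    move=> Dx; have [g [h [Gg Gh e]]] := common_translate x x0.
    have := f_hom g x Gg Dx; have := f_hom h x0 Gh Dx0.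
    by rewrite addrC [h%:Z + _]addrC -e [g%:Z + x]addrC => -> ; lia.
  exists (f x0 - x0); rewrite predeqE => y; split=> [/f_surj[x Dx <-]|Dy] /=.
    by rewrite /shift /= f_trans // addrK.
  have /f_fun : D (y - (f x0 - x0)) by [].
  by rewrite /= f_trans ?subrK.
exists (fun x => x + c); last by move=> g x _ _; rewrite addrA.
split.
- by move=> x Dx; rewrite /shift /= addrK.
- by move=> x y _ _; apply: addIr.
- by move=> y Dy; exists (y - c); rewrite ?subrK.
Qed.

Lemma shiftD c d D : shift c (shift d D) = shift (c + d) D.
Proof. by rewrite predeqE => x; rewrite /shift /= opprD addrA. Qed.

Lemma shift0 D : shift 0 D = D.
Proof. by rewrite predeqE => x; rewrite /shift /= subr0. Qed.

Lemma shiftK c D : shift (- c) (shift c D) = D.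
Proof. by rewrite shiftD addNr shift0. Qed.

Lemma shift_nonempty c D : D !=set0 -> shift c D !=set0.
Proof. by case=> x Dx; exists (x + c); rewrite /shift /= addrK. Qed.

Lemma shift_semimodule c D : semimodule G D -> semimodule G (shift c D).
Proof.
case=> neD [m lbD] clD; split; first exact: shift_nonempty.
  by exists (m + c) => x /lbD; lia.
by move=> x g; rewrite /shift /= => Dx Gg; rewrite addrAC; apply: clD.
Qed.

Lemma iso_class_shift c D : semimodule G D ->
  iso_class G (shift c D) = iso_class G D.
Proof.
move=> [neD _ _]; rewrite predeqE => D'; split=> -[smD']; rewrite /iso_class /=.
  rewrite isomorphicE; last exact: shift_nonempty.
  case=> d def_D'; split=> //; apply/isomorphicE => //.
  by exists (d + c); rewrite def_D' shiftD.
rewrite isomorphicE // => -[d def_D']; split=> //; apply/isomorphicE.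
  exact: shift_nonempty.
by exists (d - c); rewrite shiftD subrK def_D'.
Qed.

Lemma iso_class_eq D D' : semimodule G D -> semimodule G D' ->
  iso_class G D = iso_class G D' -> exists c, D' = shift c D.
Proof.
move=> smD smD' eqDD'; have [neD _ _] := smD; have [neD' _ _] := smD'.
have : iso_class G D' D'.
  by split=> //; apply/isomorphicE => //; exists 0; rewrite shift0.
by rewrite -eqDD' => -[_ /isomorphicE]; apply.
Qed.

(** Bounded below and not empty, a semimodule has no period. *)
Lemma shift_aperiodic c D : semimodule G D -> shift c D = D -> c = 0.
Proof.
case=> -[x Dx] [m lbD] _; wlog c_ge0 : c / 0 <= c => [H|per_c].
  case: (leP 0 c) => [/H//|c_lt0 per_c].
  have : - c = 0 by apply: H; [lia|rewrite -{1}per_c shiftK].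
  by lia.
have iter n : D (x - n%:Z * c).
  elim: n => [|n IHn]; first by rewrite mul0r subr0.
  rewrite -per_c /shift /= in IHn.
  by rewrite -addn1 PoszD mulrDl mul1r opprD addrA.
have := lbD _ (iter (`|x - m| + 1)%N); have := lbD _ Dx; nia.
Qed.

(** * Centered semimodules and their profiles *)

Definition centered (D : set int) : Prop :=
  forall x, D x <-> ~ D (beta%:Z - alpha%:Z - x).

(** The staircases bounding centered semimodules: [profileS] and [profileD]
    express closure under adding [beta] and the two ways of writing a point,
    and [profileN] is the central symmetry. *)
Record profile (t : int -> int) : Prop := Profile {
  profileS : forall k, t k <= t (k + 1);
  profileD : forall k, t (k + alpha%:Z) = t k + beta%:Z;
  profileN : forall k, t (- 1 - k) = - t k
}.

Definition region (t : int -> int) : set int :=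
  [set x | exists j k : int, x = pt j k /\ t k <= j].

Lemma profile_mono t k k' : profile t -> k <= k' -> t k <= t k'.
Proof.
move=> prt le_kk'; have -> : k' = k + `|k' - k|%N%:Z by lia.
elim: `|k' - k|%N => [|n IHn]; first by rewrite addr0.
by rewrite (le_trans IHn) // -addn1 PoszD addrA profileS.
Qed.

Lemma profileMD t k q :
  profile t -> t (k + q * alpha%:Z) = t k + q * beta%:Z.
Proof.
move=> prt.
have nat_case (n : nat) k1 :
    t (k1 + n%:Z * alpha%:Z) = t k1 + n%:Z * beta%:Z.
  elim: n => [|n IHn]; first by rewrite !mul0r !addr0.
  by rewrite -addn1 PoszD !mulrDl !mul1r !addrA profileD // IHn.
case: (leP 0 q) => q0.
  by have -> : q = `|q|%N%:Z by lia.
have := nat_case `|q|%N (k + q * alpha%:Z).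
have -> : `|q|%N%:Z = - q by lia.
by rewrite !mulNr addrK; lia.
Qed.

(** Thanks to [profileD], membership does not depend on the choice of the
    coordinates of the point. *)
Lemma region_pt t j k : profile t -> region t (pt j k) <-> t k <= j.
Proof.
move=> prt; split=> [[j' [k' [/pt_inj[q [-> ->]]]]]|le_tj].
  by rewrite profileMD // lerD2r.
by exists j, k.
Qed.

Lemma region_semimodule t : profile t -> semimodule G (region t).
Proof.
move=> prt; split.
- by exists (pt (t 0) 0), (t 0), 0.
- exists (t 0 * alpha%:Z - alpha%:Z * beta%:Z) => x.
  have [j [k [-> /andP[k_ge0 lt_k]]]] := pt_window 0 x.
  rewrite region_pt // /pt => le_tj; have := profile_mono prt k_ge0 => le_t0.
  by apply: lerB; rewrite ler_wpM2r //; lia.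
move=> _ _ [j [k [-> le_tj]]] [r [s ->]].
exists (j + r%:Z), (k - s%:Z); split; first by rewrite /pt; lia.
have : t (k - s%:Z) <= t k by apply: profile_mono => //; lia.
by lia.
Qed.

Lemma region_centered t : profile t -> centered (region t).
Proof.
move=> prt x; have [j [k ->]] := pt_surj x.
have -> : beta%:Z - alpha%:Z - pt j k = pt (- 1 - j) (- 1 - k).
  by rewrite /pt; lia.
by rewrite !region_pt // profileN //; lia.
Qed.

Lemma least_int (P : int -> Prop) : (exists x, P x) ->
  (forall x y, P x -> x <= y -> P y) -> (exists m, forall x, P x -> m <= x) ->
  exists t, forall x, P x <-> t <= x.
Proof.
move=> [x0 Px0] P_up [m m_lb].
have exP : exists n : nat, `[< P (m + n%:Z) >].
  have := m_lb _ Px0; exists `|x0 - m|%N; apply/asboolP.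
  by have -> : m + `|x0 - m|%N%:Z = x0 by lia.
case: (ex_minnP exP) => n /asboolP Pn n_min; exists (m + n%:Z) => x.
split=> [Px|]; last exact: P_up.
have le_mx := m_lb _ Px.
have := n_min `|x - m|%N; have -> : m + `|x - m|%N%:Z = x by lia.
by move=> /(_ (introT (asboolP _) Px)); lia.
Qed.

(** [t k] is the least [j] with [pt j k] in [D]. *)
Lemma exists_profile D : semimodule G D -> centered D ->
  exists2 t, profile t & D = region t.
Proof.
move=> [[x0 Dx0] [m lbD] clD] cD.
have clDab (r s : nat) (x y : int) :
    D x -> y = x + (r * alpha + s * beta)%N -> D y.
  by move=> Dx ->; apply: clD => //; exists r, s.
have [t Dt] : {t : int -> int & forall k j, D (pt j k) <-> t k <= j}.
  apply: (@choice _ _ (fun k t => forall j, D (pt j k) <-> t <= j)) => k.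
  apply: (least_int (P := fun j => D (pt j k))).
  - have [j0 [k0 def_x0]] := pt_surj x0.
    (* moving to [k - |k - k0| * alpha <= k0] makes both steps from [x0]
       nonnegative *)
    exists (j0 + `|k - k0|%N%:Z * beta%:Z).
    apply: (clDab 0%N `|(k0 - k + `|k - k0|%N%:Z * alpha%:Z)%R|%N _ _ Dx0).
    have : (0 : int) <= (alpha%:Z - 1) * `|k - k0|%N%:Z.
      by rewrite mulr_ge0 //; lia.
    by rewrite def_x0 /pt; nia.
  - move=> j j' Dj le_jj'; apply: (clDab `|j' - j|%N 0%N _ _ Dj).
    by rewrite /pt; nia.
  exists (- `|m + k * beta%:Z|) => j /lbD; rewrite /pt => le_mj.
  rewrite leNgt; apply/negP => lt_j.
  have : 0 <= (alpha%:Z - 1) * (- j) by rewrite mulr_ge0 //; lia.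
  by lia.
exists t; last first.
  rewrite predeqE => x; split=> [Dx|[j [k [-> ]]]]; last by rewrite Dt.
  have [j [k def_x]] := pt_surj x.
  by exists j, k; rewrite -Dt -def_x.
have eq_le (u v : int) : (forall j, (u <= j) <-> (v <= j)) -> u = v.
  move=> uv; apply/eqP; rewrite eq_le; apply/andP.
  by split; [rewrite uv|rewrite -uv].
split=> k.
- rewrite -Dt; apply: (clDab 0%N 1%N (pt (t (k + 1)) (k + 1))).
    by rewrite Dt.
  by rewrite /pt; lia.
- apply: eq_le => j; rewrite -Dt.
  have -> : pt j (k + alpha%:Z) = pt (j - beta%:Z) k by rewrite /pt; lia.
  by rewrite Dt; lia.
apply: eq_le => j; rewrite -Dt.
have := cD (pt j (- 1 - k)).
have -> : beta%:Z - alpha%:Z - pt j (- 1 - k) = pt (- 1 - j) k.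
  by rewrite /pt; lia.
by rewrite !Dt; lia.
Qed.

(** Composing the two reflections gives a translation that preserves [D]. *)
Lemma centered_shift_uniq c D : semimodule G D ->
  centered D -> centered (shift c D) -> c = 0.
Proof.
move=> smD cD cD'.
suff : c + c = 0 by lia.
apply: (shift_aperiodic smD); rewrite predeqE => x.
have := cD' (x - c); rewrite /shift /=.
have -> : beta%:Z - alpha%:Z - (x - c) - c = beta%:Z - alpha%:Z - x by lia.
have -> : x - c - c = x - (c + c) by lia.
by rewrite -cD.
Qed.

(** The parities enter here: they make [beta - alpha] odd, and the centre of
    symmetry of a selfdual [D] can only be a half-integer, so that an integral
    translation brings one to the other. *)
Lemma selfdual_centered a b D : alpha = (2 * a)%N -> beta = (2 * b + 1)%N ->
  semimodule G D -> selfdual G D <-> exists c, centered (shift c D).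
Proof.
move=> alphaE betaE smD; have [[x Dx] [m lbD] _] := smD.
rewrite /selfdual isomorphicE //; last first.
  rewrite dualE //; exists (F - (m - 1)) => /=.
  have -> : F - (F - (m - 1)) = m - 1 by lia.
  by move=> /lbD; lia.
rewrite dualE //; split=> [[c def_D]|[e cD]].
  have sym z : D z <-> ~ D (F + c - z).
    rewrite {1}def_D /shift /=.
    by have -> : F - (z - c) = F + c - z by lia.
  have [z def_z] : exists z, F + c = 2 * z \/ F + c = 2 * z + 1.
    by exists ((F + c) %/ 2)%Z; lia.
  case: def_z => def_z.
    (* the reflection cannot fix the integer [z] *)
    have := sym z; have -> : F + c - z = z by lia.
    tauto.
  exists (b%:Z - a%:Z - z) => y; rewrite /shift /= sym.
  by have -> : F + c - (y - (b%:Z - a%:Z - z)) =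
     beta%:Z - alpha%:Z - y - (b%:Z - a%:Z - z) by lia.
exists (beta%:Z - alpha%:Z - F - 2 * e); rewrite predeqE => y.
have := cD (y + e); rewrite /shift /= addrK => ->.
by have -> : F - (y - (beta%:Z - alpha%:Z - F - 2 * e)) =
  beta%:Z - alpha%:Z - (y + e) - e by lia.
Qed.

(** * Minimal generators *)

Definition irreducibles (D : set int) : set int :=
  [set x | [/\ D x, ~ D (x - alpha%:Z) & ~ D (x - beta%:Z)]].

Lemma irreducibles_sub_generators D E : semimodule G D -> generates G E D ->
  irreducibles D `<=` E.
Proof.
move=> smD [subED genE] x [Dx nDa nDb].
move: (Dx); rewrite -genE => -[e Ee [g [r [s ->]] def_x]].
have clD r' s' : D (e + (r' * alpha + s' * beta)%N).
  by case: smD => _ _; apply; [exact: subED|exists r', s'].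
case: r => [|r] in def_x *; last first.
  by case: nDa; have -> : x - alpha%:Z = e + (r * alpha + s * beta)%N by lia.
case: s => [|s] in def_x *; last first.
  by case: nDb; have -> : x - beta%:Z = e + (0 * alpha + s * beta)%N by lia.
by have -> : x = e by lia.
Qed.

(** Subtracting [alpha] or [beta] as long as possible ends, since [D] is
    bounded below. *)
Lemma irreducibles_generate D :
  semimodule G D -> generates G (irreducibles D) D.
Proof.
move=> smD; split=> [x []//|]; rewrite predeqE => x; split.
  by case=> e [De _ _] [g Gg <-]; case: smD => _ _; apply.
have [_ [m lbD] _] := smD.
have [n] := ubnP `|x - m|%N; elim: n => // n IHn in x * => lt_n Dx.
have step g : (0 < g)%N -> G g -> D (x - g%:Z) ->
    (\bigcup_(x0 in irreducibles D) [set x0 + g0%:Z | g0 in G]) x.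
  move=> g_gt0 Gg Dxg; have le_m := lbD _ Dxg.
  have [|//|e irr_e [h Gh def_h]] := IHn (x - g%:Z); first by lia.
  exists e => //; exists (h + g)%N; last by rewrite PoszD; lia.
  have [_ addG _] := semigroup2_numerical alpha_gt0 co_alpha_beta.
  exact: addG.
have [Da|nDa] := pselect (D (x - alpha%:Z)).
  by apply: step Da => //; exact: gen_alpha.
have [Db|nDb] := pselect (D (x - beta%:Z)).
  by apply: step Db => //; exact: gen_beta.
exists x => //; exists 0%N; last by rewrite addr0.
by exists 0%N, 0%N.
Qed.

(** The irreducibles lie in every system of generators and are one. *)
Lemma minimal_generatorsE D E : semimodule G D ->
  minimal_generators G E D <-> E = irreducibles D.
Proof.
move=> smD; split=> [[genE minE]|->].
  by rewrite (minE (irreducibles D)) //; [exact: irreducibles_sub_generators|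
     exact: irreducibles_generate].
split=> [|E' sub genE']; first exact: irreducibles_generate.
by apply/seteqP; split=> //; apply: irreducibles_sub_generators.
Qed.

Lemma has_num_generatorsE D n : semimodule G D ->
  has_num_generators G D n <-> irreducibles D #= `I_n.
Proof.
move=> smD; split=> [[E /(minimal_generatorsE _ smD) -> //]|cardD].
by exists (irreducibles D) => //; apply/minimal_generatorsE.
Qed.

Lemma irreducibles_shift c D :
  irreducibles (shift c D) = (fun x => x + c) @` irreducibles D.
Proof.
rewrite predeqE => x; rewrite /irreducibles /shift /=; split.
  by rewrite !(addrAC x _ (- c)) => irr_x; exists (x - c); rewrite ?subrK.
case=> y irr_y <-; rewrite addrK.
by rewrite !(addrAC (y + c) _ (- c)) addrK.
Qed.

Lemma has_num_generators_shift c D n : semimodule G D ->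
  has_num_generators G (shift c D) n <-> has_num_generators G D n.
Proof.
move=> smD; rewrite !has_num_generatorsE //; last exact: shift_semimodule.
rewrite irreducibles_shift.
have e : (fun x => x + c) @` irreducibles D #= irreducibles D.
  by apply: inj_card_eq => x y _ _; apply: addIr.
split; first exact: card_eq_trans (card_esym e).
exact: card_eq_trans.
Qed.

Lemma card_seq (T : choiceType) (s : seq T) :
  uniq s -> [set x | x \in s] #= `I_(size s).
Proof.
case: s => [|x0 s'] /= => [_|].
  by rewrite II0 (_ : mkset _ = set0) ?card_eqxx // predeqE.
set s := x0 :: s' => us.
have -> : [set x | x \in s] = nth x0 s @` `I_(size s).
  rewrite predeqE => x; split=> [/(nthP x0)[i lt_i <-]|[i lt_i <-]] /=.
    by exists i.
  exact: mem_nth.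
apply: inj_card_eq => i j; rewrite !inE /= => lt_i lt_j /eqP.
by rewrite nth_uniq // => /eqP.
Qed.

(** The points [pt j k] with fixed [k] contain an irreducible only at the
    boundary [j = t k], and there subtracting [beta] amounts to increasing
    [k]. *)
Lemma card_irreducibles t (c : int) : profile t ->
  irreducibles (region t) #=
    `I_(count (fun i : nat => (t (c + i%:Z) < t (c + i%:Z + 1))%R)
              (iota 0 alpha)).
Proof.
move=> prt; rewrite -size_filter; set s := filter _ _.
have us : uniq s by rewrite filter_uniq // iota_uniq.
apply: card_eq_trans (card_seq us).
have -> : irreducibles (region t) =
    (fun i : nat => pt (t (c + i%:Z)) (c + i%:Z)) @` [set i | i \in s].
  rewrite predeqE => x.
  have irr_pt j k :
      irreducibles (region t) (pt j k) <-> t k = j /\ t k < t (k + 1).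
    have ea : pt j k - alpha%:Z = pt (j - 1) k by rewrite /pt; lia.
    have eb : pt j k - beta%:Z = pt j (k + 1) by rewrite /pt; lia.
    have := profileS prt k.
    rewrite /irreducibles /= ea eb !(propext (region_pt _ _ prt)).
    by split=> [[]|[]]; [lia|move=> <- lt_t; split; lia].
  split=> [|[i]].
    have [j [k [-> k_c]]] := pt_window c x.
    move=> /irr_pt[<- lt_t]; have def_k : c + `|k - c|%N%:Z = k by lia.
    exists `|k - c|%N; last by rewrite /= def_k.
    by rewrite /= mem_filter mem_iota def_k lt_t; lia.
  by rewrite /= mem_filter => /andP[lt_t _] <-; apply/irr_pt.
apply: inj_card_eq => i j; rewrite !inE /= !mem_filter !mem_iota.
move=> /andP[_ lt_i] /andP[_ lt_j] /pt_inj[q [_ e]].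
suff : q = 0 by lia.
case: (ltgtP q 0) => // q0.
  have : 0 <= (-1 - q) * alpha%:Z by rewrite mulr_ge0 //; lia.
  by lia.
have : 0 <= (q - 1) * alpha%:Z by rewrite mulr_ge0 //; lia.
by lia.
Qed.

(** * Profiles encoded by nondecreasing sequences *)

Variables a b : nat.
Hypothesis alphaE : alpha = (2 * a)%N.
Hypothesis betaE : beta = (2 * b + 1)%N.

(** [Negz i] is [-1 - i], so this is the odd extension of [s] with respect to
    the reflection that exchanges [i] and [-1 - i]. *)
Definition reflect_seq (s : seq nat) (r : int) : int :=
  match r with
  | Posz i => (nth 0%N s i)%:Z
  | Negz i => - (nth 0%N s i)%:Z
  end.

Lemma reflect_seqN s r : reflect_seq s (- 1 - r) = - reflect_seq s r.
Proof.
case: r => i; first by have -> : - 1 - i%:Z = Negz i by lia.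
have -> : - 1 - Negz i = i%:Z by lia.
by rewrite /= opprK.
Qed.

Definition seq_profile (s : seq nat) (k : int) : int :=
  ((k + a%:Z) %/ alpha)%Z * beta%:Z +
  reflect_seq s (((k + a%:Z) %% alpha)%Z - a%:Z).

Lemma symmetric_window (k : int) :
  exists q r : int, k = q * alpha%:Z + r /\ - a%:Z <= r < a%:Z.
Proof.
by have [q [r [-> r_a]]] := int_window (- a%:Z) k; exists q, r; split=> //; lia.
Qed.

Lemma seq_profileE s (q r : int) : - a%:Z <= r < a%:Z ->
  seq_profile s (q * alpha%:Z + r) = q * beta%:Z + reflect_seq s r.
Proof.
move=> r_range; rewrite /seq_profile -addrA.
rewrite divzMDl; last by lia.
rewrite modzMDl divz_small; last by lia.
by rewrite addr0 modz_small ?addrK //; lia.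
Qed.

Lemma mono_seqsP s : reflect
  [/\ size s = a, forall i, (i.+1 < a)%N -> (nth 0 s i <= nth 0 s i.+1)%N &
     forall i, (nth 0 s i <= b)%N]
  (s \in mono_seqs a b 0).
Proof.
rewrite mem_mono_seqs; apply: (iffP and3P) => [[/eqP sz ps al]|[sz asc le_b]].
  split=> // [i lt_i|i].
    by have /(pathP 0%N) /(_ i.+1) := ps; rewrite sz; apply.
  case: (ltnP i (size s)) => [lt_i|le_i]; last by rewrite nth_default.
  by have /(all_nthP 0%N) /(_ i lt_i) := al.
split; first exact/eqP.
  apply/(pathP 0%N) => -[|i] //; rewrite sz; exact: asc.
by apply/(all_nthP 0%N) => i _; apply: le_b.
Qed.

(** Monotonicity within a period is that of [s]; from the end of a period to
    the next it says that [nth 0 s a.-1 <= beta - nth 0 s a.-1], which is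
    the bound by [b]. *)
Lemma seq_profile_profile s : s \in mono_seqs a b 0 -> profile (seq_profile s).
Proof.
move=> /mono_seqsP[sz asc le_b]; split=> k.
- have [q [r [-> r_range]]] := symmetric_window k.
  rewrite seq_profileE // -addrA; case: (ltP (r + 1) a) => lt_r.
    rewrite seq_profileE ?lerD2l; last by lia.
    case: r r_range lt_r => [i _ lt_i|[|i] r_range _].
    + by rewrite /= addn1 lez_nat; apply: asc; lia.
    + by rewrite /=; lia.
    have -> : Negz i.+1 + 1 = Negz i by lia.
    by rewrite /= lerN2 lez_nat; apply: asc; lia.
  (* [r = a - 1], the last place of the period *)
  have -> : r + 1 = alpha%:Z - a%:Z by lia.
  have -> : q * alpha%:Z + (alpha%:Z - a%:Z) = (q + 1) * alpha%:Z + - a%:Z.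
    by lia.
  have -> : r = a.-1 by lia.
  have -> : - a%:Z = -1 - a.-1%:Z by lia.
  rewrite seq_profileE; last by lia.
  by rewrite reflect_seqN /=; have := le_b a.-1; lia.
- have [q [r [-> r_range]]] := symmetric_window k.
  have -> : q * alpha%:Z + r + alpha%:Z = (q + 1) * alpha%:Z + r by lia.
  by rewrite !seq_profileE //; lia.
have [q [r [-> r_range]]] := symmetric_window k.
have -> : -1 - (q * alpha%:Z + r) = (- q) * alpha%:Z + (-1 - r) by lia.
by rewrite !seq_profileE ?reflect_seqN //; lia.
Qed.

Lemma seq_profile_nat s i : (i < a)%N -> seq_profile s i = nth 0%N s i.
Proof.
move=> lt_i; have := @seq_profileE s 0 i; rewrite !mul0r !add0r => -> //; lia.
Qed.

Lemma profile_ext t t' : profile t -> profile t' ->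
  (forall i : nat, (i < a)%N -> t i = t' i) -> t = t'.
Proof.
move=> prt prt' eqt; apply: funext => k.
have [q [r [-> r_range]]] := symmetric_window k.
rewrite addrC !profileMD //; congr (_ + _).
case: r r_range => i r_range; first by apply: eqt; lia.
have -> : Negz i = - 1 - i%:Z by lia.
by rewrite !profileN // eqt //; lia.
Qed.

(** The bounds come from the symmetry: [t (-1) <= t 0] says that [t 0] is not
    negative, and [t i <= t (alpha - 1 - i) = beta - t i] that [t i] is at
    most [b]. *)
Lemma profile_seq t : profile t ->
  exists2 s, s \in mono_seqs a b 0 & t = seq_profile s.
Proof.
move=> prt.
have t0_ge0 : 0 <= t 0.
  have : - t 0 <= t 0 by rewrite -profileN //; apply: profile_mono.
  by move: (t 0) => u; lia.
have t_ge0 (i : nat) : 0 <= t i by apply: le_trans t0_ge0 (profile_mono prt _).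
have t_leb (i : nat) : (i < a)%N -> t i <= b.
  move=> lt_i; have : t i <= t (- 1 - i%:Z + alpha%:Z).
    by apply: profile_mono => //; lia.
  by rewrite profileD // profileN //; lia.
pose s := mkseq (fun i => `|t i|%N) a.
have s_in : s \in mono_seqs a b 0.
  apply/mono_seqsP; split=> [|i lt_i|i]; first by rewrite size_mkseq.
    rewrite !nth_mkseq //; last by lia.
    have := t_ge0 i; have := t_ge0 i.+1; have := profileS prt i.
    have -> : i%:Z + 1 = i.+1%:Z by lia.
    by lia.
  case: (ltnP i a) => [lt_i|le_i]; last by rewrite nth_default // size_mkseq.
  by rewrite nth_mkseq //; have := t_leb i lt_i; have := t_ge0 i; lia.
exists s => //; apply: profile_ext => // [|i lt_i].
  exact: seq_profile_profile.
by rewrite seq_profile_nat // nth_mkseq //; have := t_ge0 i; lia.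
Qed.

Lemma seq_profile_inj s s' :
  s \in mono_seqs a b 0 -> s' \in mono_seqs a b 0 ->
  region (seq_profile s) = region (seq_profile s') -> s = s'.
Proof.
move=> s_in s'_in eq_reg.
have [sz _ _] := mono_seqsP _ s_in; have [sz' _ _] := mono_seqsP _ s'_in.
apply: (@eq_from_nth _ 0%N) => [|i]; rewrite sz // => lt_i.
suff : seq_profile s i = seq_profile s' i by rewrite !seq_profile_nat //; lia.
have prs := seq_profile_profile s_in; have prs' := seq_profile_profile s'_in.
apply/eqP; rewrite eq_le; apply/andP; split.
  by rewrite -region_pt // eq_reg region_pt.
by rewrite -region_pt // -eq_reg region_pt.
Qed.

(** Ascents are counted over the period from [-a] to [a - 1]: the right half
    has those of [s] and the step to the next period, the left half those of
    [s] read backwards and the step from -1 to 0. *)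
Lemma seq_profile_generators s n : s \in mono_seqs a b 0 ->
  has_num_generators G (region (seq_profile s)) n <-> n = num_jumps s.
Proof.
move=> s_in; have prs := seq_profile_profile s_in.
have [sz _ le_b] := mono_seqsP _ s_in.
rewrite has_num_generatorsE; last exact: region_semimodule.
have card_irr := card_irreducibles (- a%:Z) prs.
have -> : num_jumps s = count (fun i : nat =>
    seq_profile s (- a%:Z + i%:Z) < seq_profile s (- a%:Z + i%:Z + 1))
    (iota 0 alpha).
  have {card_irr} [a' def_a] : exists a', a = a'.+1 by exists a.-1; lia.
  have count_iota (p : pred nat) m n0 :
      count p (iota m n0) = (\sum_(i < n0) p (m + i))%N.
    elim: n0 m => [|n0 IHn] m; first by rewrite big_ord0.
    rewrite big_ord_recl /= addn0 IHn; congr (_ + _)%N.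
    by apply: eq_bigr => i _; rewrite /bump /= addnCA add1n.
  have profile_reflect (r : int) :
      - a%:Z <= r < a%:Z -> seq_profile s r = reflect_seq s r.
    by move=> /(seq_profileE s 0); rewrite !mul0r !add0r.
  have -> : alpha = (a + a)%N by lia.
  rewrite iotaD count_cat !count_iota add0n.
  have -> : (\sum_(i < a) (seq_profile s (- a%:Z + (a + i)%N%:Z) <
        seq_profile s (- a%:Z + (a + i)%N%:Z + 1))%R = ascents s + 1)%N.
    rewrite /ascents sz def_a big_ord_recr /=; congr (_ + _)%N.
      apply: eq_bigr => i _.
      have -> : - a'.+1%:Z + (a'.+1 + i)%N%:Z = i%:Z by lia.
      have -> : i%:Z + 1 = i.+1%:Z by lia.
      by have := ltn_ord i => lt_i; rewrite !seq_profile_nat ?def_a //; lia.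
    have -> : - a'.+1%:Z + (a'.+1 + a')%N%:Z = a'%:Z by lia.
    have -> : a'%:Z + 1 = 1 * alpha%:Z + (- 1 - a'%:Z) by lia.
    rewrite seq_profileE; last by lia.
    rewrite reflect_seqN seq_profile_nat ?def_a //=.
    by have := le_b a'; lia.
  have -> : (\sum_(i < a) (seq_profile s (- a%:Z + i%:Z) <
        seq_profile s (- a%:Z + i%:Z + 1))%R = ascents s + (0 < head 0 s))%N.
    rewrite (reindex_inj rev_ord_inj) /=.
    transitivity (\sum_(i < a)
        (reflect_seq s (-1 - i%:Z) < reflect_seq s (- i%:Z))%R)%N.
      apply: eq_bigr => i _; have := ltn_ord i => lt_i.
      have -> : - a%:Z + (a - i.+1)%N%:Z = -1 - i%:Z by lia.
      have -> : -1 - i%:Z + 1 = - i%:Z by lia.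
      by rewrite !profile_reflect //; lia.
    rewrite /ascents sz def_a big_ord_recl addnC /=; congr (_ + _)%N.
      by apply: eq_bigr => i _; rewrite !add0n ltrN2.
    by rewrite -nth0 subnn; lia.
  by rewrite /num_jumps; lia.
split=> [irr_n|->//].
by apply/card_eq_II/(card_eq_trans (card_esym irr_n)).
Qed.

(** * Counting isomorphism classes *)

(** Each class of selfdual semimodules contains exactly one centered one, which
    is the region of exactly one sequence. *)
Lemma card_classes (Q : set (set int)) (P : pred (seq nat)) :
  (forall c D, semimodule G D -> Q (shift c D) <-> Q D) ->
  (forall s, s \in mono_seqs a b 0 -> Q (region (seq_profile s)) <-> P s) ->
  count_up_to_iso G [set D | selfdual G D /\ Q D] (count P (mono_seqs a b 0)).
Proof.
move=> Q_shift Q_P; rewrite /count_up_to_iso -size_filter.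
set ss := [seq s <- _ | _].
have uss : uniq ss by rewrite filter_uniq ?mono_seqs_uniq.
apply: card_eq_trans (card_seq uss).
have in_ss s : s \in ss -> s \in mono_seqs a b 0 /\ P s.
  by rewrite mem_filter => /andP[].
have -> : [set iso_class G D | D in [set D | semimodule G D /\
    [set D | selfdual G D /\ Q D] D]] =
    (fun s => iso_class G (region (seq_profile s))) @` [set s | s \in ss].
  apply/seteqP; split=> [_ [D [smD [sdD QD]] <-]|_ [s /in_ss[s_in Ps] <-]] /=.
    have [c cD] := (selfdual_centered alphaE betaE smD).1 sdD.
    have [t prt def_D] := exists_profile (shift_semimodule c smD) cD.
    have [s s_in def_t] := profile_seq prt.
    exists s; last by rewrite -def_t -def_D iso_class_shift.
    rewrite /= mem_filter s_in andbT; apply/Q_P => //.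
    by rewrite -def_t -def_D; apply/Q_shift.
  have prs := seq_profile_profile s_in; have smD := region_semimodule prs.
  exists (region (seq_profile s)) => //; split=> //; split; last exact/Q_P.
  apply/(selfdual_centered alphaE betaE smD); exists 0; rewrite shift0.
  exact: region_centered.
apply: inj_card_eq => s s'; rewrite !inE /= => /in_ss[s_in _] /in_ss[s'_in _].
have prs := seq_profile_profile s_in; have prs' := seq_profile_profile s'_in.
have smD := region_semimodule prs; have smD' := region_semimodule prs'.
move=> /(iso_class_eq smD smD')[c def_D'].
apply: seq_profile_inj => //.
suff c0 : c = 0 by rewrite def_D' c0 shift0.
apply: (centered_shift_uniq smD); first exact: region_centered.
by rewrite -def_D'; apply: region_centered.
Qed.

Lemma card_selfdual_classes : count_up_to_iso G (selfdual G) 'C(a + b, a).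
Proof.
rewrite -(size_mono_seqs a b 0) -count_predT.
have -> : selfdual G = [set D | selfdual G D /\ True].
  by rewrite predeqE => D; split=> [|[]].
exact: card_classes.
Qed.

Lemma card_selfdual_generators n :
  count_up_to_iso G [set D | selfdual G D /\ has_num_generators G D n]
    (count (fun s => num_jumps s == n) (mono_seqs a b 0)).
Proof.
apply: card_classes => [c D smD|s s_in]; first exact: has_num_generators_shift.
by rewrite seq_profile_generators //; split=> [->|/eqP ->].
Qed.

End TwoGenerators.

Theorem theorem5p3 (alpha beta : nat)
    (alpha_gt0 : (0 < alpha)%N) (lt_alpha_beta : (alpha < beta)%N)
    (co_alpha_beta : coprime alpha beta)
    (alpha_even : ~~ odd alpha) (beta_odd : odd beta) :
  let G := semigroup2 alpha beta in
  [/\ count_up_to_iso G (selfdual G) 'C(alpha./2 + beta./2, alpha./2),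
      forall l : nat, (l <= alpha./2 - 1)%N ->
        count_up_to_iso G
          [set D | selfdual G D /\ has_num_generators G D (2 * l + 1)]
          ('C(alpha./2 - 1, l) * 'C(beta./2, l))%N
    & forall l : nat, (1 <= l <= alpha./2)%N ->
        count_up_to_iso G
          [set D | selfdual G D /\ has_num_generators G D (2 * l)]
          ('C(alpha./2 - 1, l - 1) * 'C(beta./2, l))%N].
Proof.
have beta_gt0 : (0 < beta)%N by lia.
have alphaE : alpha = (2 * alpha./2)%N by lia.
have betaE : beta = (2 * beta./2 + 1)%N by lia.
have [a def_a] : exists a, alpha./2 = a.+1 by exists (alpha./2).-1; lia.
have [b def_b] : exists b, beta./2 = b.+1 by exists (beta./2).-1; lia.
rewrite def_a def_b subn1 /= in alphaE betaE *.
split=> [|l _|[//|l] _]; first exact: card_selfdual_classes.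
  by rewrite -count_jumps_odd; apply: card_selfdual_generators.
by rewrite subn1 -count_jumps_even; apply: card_selfdual_generators.
Qed.
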